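(* Let $A,B$ be nonzero integers, and let $\{u_n\}_{n\ge0}$, $\{v_n\}_{n\ge0}$ be the Lucas sequences defined by $u_0=0$, $u_1=1$, $u_n=Au_{n-1}-Bu_{n-2}$ for $n\ge2$, and $v_0=2$, $v_1=A$, $v_n=Av_{n-1}-Bv_{n-2}$ for $n\ge2$. Let $\Delta=A^2-4B$. For each positive integer $n$, let $w_n$ be the largest divisor of $u_n$ that is coprime to each of $u_1,u_2,\ldots,u_{n-1}$. Then for every integer $n\ge5$, $$\sum_{j=1}^{n-1}\frac{v_j}{u_j}\equiv\frac{(n^2-1)\Delta}{6}\cdot\frac{u_n}{v_n}\pmod{w_n^2}.$$
   Context: A congruence between rational numbers modulo an integer $M$ means that the difference, written as a fraction whose denominator is coprime to $M$, has numerator divisible by $M$. *)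

(* Defs.v *)
From HB Require Import structures.
From mathcomp Require Import all_boot all_order all_algebra.
Set Implicit Arguments. Unset Strict Implicit. Unset Printing Implicit Defensive.
Import Order.TTheory GRing.Theory Num.Theory.
Local Open Scope ring_scope.

Definition rat_congr (M : int) (x y : rat) : Prop :=
  exists a b : int, coprimez b M /\ (M %| a)%Z /\ x - y = a%:~R / b%:~R.

Definition is_wn (u : nat -> int) (n : nat) (w : int) : Prop :=
  [/\ 0 < w, (w %| u n)%Z,
      (forall j, (1 <= j < n)%N -> coprimez w (u j)) &
      (forall d : int, (d %| u n)%Z ->
          (forall j, (1 <= j < n)%N -> coprimez d (u j)) -> d <= w)].

(* Main.v *)
(** Modulo w put x_j = v_j / u_j for 0 < j < n. Since w divides u_n, these behave
    like the values sqrt(Delta) * coth at the nonzero points of Z/n: x_(n-j) = -x_j,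
    and x_i x_j + x_j x_k + x_k x_i = -Delta whenever n divides i + j + k, because
    the left side plus Delta is 4 u_(i+j+k) / (u_i u_j u_k). Summing this over all
    (n-1)(n-2) such triples gives 3 sum_j x_j^2 = -(n-1)(n-2) Delta.

    Over the rationals, pairing j with n-j gives
    sum_j v_j / u_j = u_n sum_j 1 / (u_j u_(n-j)), so one factor w comes from u_n and
    the last sum is only needed modulo w. There 2 v_n / (u_j u_(n-j)) = Delta - x_j^2,
    and the previous evaluation yields (n^2-1) Delta / (6 v_n) for it. *)
Require Import Defs.
From HB Require Import structures.
From mathcomp Require Import all_boot all_order all_algebra.
From mathcomp Require Import ring zify.
Import Order.TTheory GRing.Theory Num.Theory.
Local Open Scope ring_scope.

(** * Zero-sum triples in a finite abelian group *)

(* Summing the relation over all triples of nonzero elements with sum zero,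
   rather than reading the sum off a polynomial with roots [x i] and leading
   coefficient [#|G|], keeps the identity valid when [#|G|] is not a unit. *)
Lemma sum_sqr_odd_triples (G : finZmodType) (R : comUnitRingType) (x : G -> R) (D : R) :
    (2 : R) \is a GRing.unit -> x 0 = 0 -> (forall i, x (- i) = - x i) ->
    (forall i j k, i != 0 -> j != 0 -> k != 0 -> i + j + k = 0 ->
      x i * x j + x j * x k + x k * x i = - D) ->
  3 * \sum_i x i ^+ 2 = - ((#|G|.-1 * #|G|.-2)%:R * D).
Proof.
move=> u2 x0 xN xD.
have sx0 : \sum_i x i = 0.
  apply: (mulrI u2); rewrite mulr0 mulr2n mulrDl mul1r.
  rewrite {2}(reindex_inj oppr_inj) -big_split /= big1 // => i _.
  by rewrite xN subrr.
(* A pair [(i, j)] in [P] stands for the triple [(i, j, -(i + j))] of nonzero elements. *)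
pose P (p : G * G) := [&& p.1 != 0, p.2 != 0 & p.1 + p.2 != 0].
pose T (F : G -> G -> R) := \sum_(p | P p) F p.1 p.2.
(* The full double sum is [(\sum_i x i) ^+ 2 = 0]. Outside [P] only the pairs [(i, -i)] contribute,
   and they add up to [- \sum_i x i ^+ 2]. *)
have sq : T (fun i j => x i * x j) = \sum_i x i ^+ 2.
  have : \sum_i \sum_j x i * x j = 0.
    by rewrite -big_distrlr /= sx0 mul0r.
  rewrite pair_big /= (bigID P) /= -/(T (fun i j => x i * x j)) => /eqP.
  rewrite addr_eq0 => /eqP ->; rewrite -sumrN.
  rewrite (bigID (fun p : G * G => p.1 + p.2 == 0)) /= addrC big1 ?add0r.
    rewrite (reindex_onto (fun i : G => (i, - i)) fst) /=; last first.
      by case=> i j /= /andP[_]; rewrite addrC addr_eq0 => /eqP ->.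
    apply: eq_big => [i|i _]; last by rewrite xN mulrN opprK.
    by rewrite /P /= subrr !eqxx /= !andbF.
  case=> i j /= /andP[]; rewrite /P /= !negb_and !negbK => /or3P[] /eqP -> //.
  - by rewrite x0 mul0r oppr0.
  - by rewrite x0 mulr0 oppr0.
  - by rewrite eqxx.
(* Rotating a triple cyclically permutes [P], so the three products in the relation have equal
   sums. *)
have rot F : T F = T (fun i j => F j (- (i + j))).
  rewrite /T (reindex_inj (h := fun p : G * G => (p.2, - (p.1 + p.2)))) /=.
    apply: eq_bigl => -[i j]; rewrite /P /= oppr_eq0 opprD addrCA subrr addr0 oppr_eq0.
    by case: (i == 0); case: (j == 0); case: (i + j == 0).
  by move=> [i j] [i' j'] /= [<-] /oppr_inj /addIr ->.
have e3 : T (fun i j => x i * x j) *+ 3 = - (T (fun _ _ => D)).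
  have r1 := rot (fun i j => x i * x j).
  have /= r2 := rot (fun i j => x j * x (- (i + j))).
  rewrite 2!mulrS mulr1n {2}r1 {2}r1 {2}r2 -!big_split -sumrN /=.
  apply: eq_bigr => -[i j] /and3P[/= i0 j0 ij0].
  rewrite -(xD i j (- (i + j))) ?oppr_eq0 ?subrr //.
  have -> : - (j + - (i + j)) = i by rewrite opprD opprK addrC addrK.
  ring.
(* Once [i] is chosen, [j] must avoid [0] and [- i], which differ because [i != 0]. *)
have cP : T (fun _ _ => D) = (#|G|.-1 * #|G|.-2)%:R * D.
  transitivity (\sum_(i : G | i != 0) \sum_(j : G | (j != 0) && (i + j != 0)) D).
    by rewrite pair_big_dep.
  transitivity (\sum_(i : G | i != 0) #|G|.-2%:R * D).
    apply: eq_bigr => i i0; rewrite sumr_const mulr_natl; congr (_ *+ _).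
    have /eqP := cardC (pred2 0 (- i)); rewrite card2 (eq_sym 0 (- i)) oppr_eq0 i0 => /eqP <-.
    rewrite addnC addn2 /=; apply: eq_card => j; rewrite !inE negb_or.
    by rewrite unfold_in -addr_eq0 (addrC j i).
  by rewrite sumr_const -[LHS]mulr_natl mulrA -natrM (cardC1 (0 : G)).
by rewrite -cP -e3 sq mulr_natl.
Qed.

(** * Addition formulas and norm identity for Lucas sequences *)

Section Lucas.
Variables (R : comNzRingType) (A B : R) (u v : nat -> R).
Hypotheses (hu0 : u 0%N = 0) (hu1 : u 1%N = 1)
  (hu : forall n : nat, u n.+2 = A * u n.+1 - B * u n)
  (hv0 : v 0%N = 2) (hv1 : v 1%N = A)
  (hv : forall n : nat, v n.+2 = A * v n.+1 - B * v n).
Let Delta := A ^+ 2 - 4 * B.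

Lemma lucas_succ m :
  2 * u m.+1 = A * u m + v m /\ 2 * v m.+1 = A * v m + Delta * u m.
Proof.
suff: (2 * u m.+1 = A * u m + v m /\ 2 * v m.+1 = A * v m + Delta * u m) /\
  (2 * u m.+2 = A * u m.+1 + v m.+1 /\ 2 * v m.+2 = A * v m.+1 + Delta * u m.+1) by case.
elim: m => [|m [[IHu IHv] [IHu' IHv']]].
  by rewrite !hu !hv hu0 hu1 hv0 hv1 /Delta; do !split; ring.
split=> //; rewrite [u m.+3]hu [v m.+3]hv; split.
  have -> : 2 * (A * u m.+2 - B * u m.+1) = A * (2 * u m.+2) - B * (2 * u m.+1) by ring.
  by rewrite IHu' IHu [u m.+2]hu [v m.+2]hv; ring.
have -> : 2 * (A * v m.+2 - B * v m.+1) = A * (2 * v m.+2) - B * (2 * v m.+1) by ring.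
by rewrite IHv' IHv [u m.+2]hu [v m.+2]hv; ring.
Qed.

(** These are the addition laws of sinh and cosh. Both sides obey the recurrence in [k], so the
    induction carries two consecutive indices; the factor 2 avoids division in [R]. *)
Lemma lucas_add m k :
  2 * u (m + k)%N = u m * v k + v m * u k /\
  2 * v (m + k)%N = v m * v k + Delta * u m * u k.
Proof.
suff: (2 * u (m + k)%N = u m * v k + v m * u k /\
  2 * v (m + k)%N = v m * v k + Delta * u m * u k) /\
  (2 * u (m + k.+1)%N = u m * v k.+1 + v m * u k.+1 /\
  2 * v (m + k.+1)%N = v m * v k.+1 + Delta * u m * u k.+1) by case.
elim: k => [|k [[IHu IHv] [IHu' IHv']]].
  rewrite addn0 addn1 hu0 hu1 hv0 hv1; have [-> ->] := lucas_succ m.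
  by do !split; ring.
split=> //; rewrite !addnS in IHu' IHv' *; rewrite !hu !hv; split.
  have -> : 2 * (A * u (m + k).+1 - B * u (m + k)%N)
    = A * (2 * u (m + k).+1) - B * (2 * u (m + k)%N) by ring.
  by rewrite IHu' IHu; ring.
have -> : 2 * (A * v (m + k).+1 - B * v (m + k)%N)
  = A * (2 * v (m + k).+1) - B * (2 * v (m + k)%N) by ring.
by rewrite IHv' IHv; ring.
Qed.

Lemma lucas_add3 i j k :
  4 * u (i + j + k)%N =
  u i * v j * v k + v i * u j * v k + v i * v j * u k + Delta * u i * u j * u k.
Proof.
have [e _] := lucas_add (i + j) k; have [eu ev] := lucas_add i j.
have -> : 4 * u (i + j + k)%N = 2 * (2 * u (i + j + k)%N) by ring.
rewrite e.
have -> : 2 * (u (i + j)%N * v k + v (i + j)%N * u k) =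
  2 * u (i + j)%N * v k + 2 * v (i + j)%N * u k by ring.
by rewrite eu ev; ring.
Qed.
End Lucas.

(** The analogue of cosh^2 - sinh^2 = 1. Modulo a divisor of [u m] it makes [v m ^+ 2] congruent to
    [4 * B ^+ m]. *)
Lemma lucas_norm (R : idomainType) (A B : R) (u v : nat -> R)
    (hu0 : u 0%N = 0) (hu1 : u 1%N = 1)
    (hu : forall n : nat, u n.+2 = A * u n.+1 - B * u n)
    (hv0 : v 0%N = 2) (hv1 : v 1%N = A)
    (hv : forall n : nat, v n.+2 = A * v n.+1 - B * v n) m :
  (2 : R) != 0 ->
  v m ^+ 2 - (A ^+ 2 - 4 * B) * u m ^+ 2 = 4 * B ^+ m.
Proof.
move=> n2; elim: m => [|m IH]; first by rewrite hu0 hv0; ring.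
have [eu ev] := lucas_succ _ _ _ _ _ hu0 hu1 hu hv0 hv1 hv m.
have n4 : (4 : R) != 0 by rewrite (natrM _ 2 2) mulf_neq0.
apply: (mulfI n4); transitivity ((2 * v m.+1) ^+ 2 - (A ^+ 2 - 4 * B) * (2 * u m.+1) ^+ 2).
  by ring.
by rewrite eu ev (exprS B); transitivity (4 * B * (4 * B ^+ m)); [rewrite -IH; ring|ring].
Qed.

Lemma sum_ord_neq0 (R : nmodType) n (F : nat -> R) :
  \sum_(1 <= j < n.+1) F j = \sum_(j < n.+1 | j != 0) F j.
Proof.
rewrite -[RHS](big_mkord (fun j => j != 0%N)) big_ltn_cond //=.
by rewrite big_nat_cond [RHS]big_nat_cond; apply: eq_bigl => -[|j].
Qed.

(** * Sums of ratios of Lucas terms *)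

Section LucasModulo.
Variables (R : comUnitRingType) (A B : R) (u v : nat -> R).
Hypotheses (hu0 : u 0%N = 0) (hu1 : u 1%N = 1)
  (hu : forall n : nat, u n.+2 = A * u n.+1 - B * u n)
  (hv0 : v 0%N = 2) (hv1 : v 1%N = A)
  (hv : forall n : nat, v n.+2 = A * v n.+1 - B * v n).
Let Delta := A ^+ 2 - 4 * B.
Variable n : nat.
Hypothesis uU : forall j, (0 < j < n)%N -> u j \is a GRing.unit.

Lemma lucas_sum_fold : (2 : R) \is a GRing.unit ->
  \sum_(1 <= j < n) v j / u j = u n * \sum_(1 <= j < n) (u j * u (n - j)%N)^-1.
Proof.
move=> u2; apply: (mulrI u2).
rewrite {1}mulr2n mulrDl mul1r {1}big_nat_rev /= -big_split /= !mulr_sumr.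
apply: eq_big_nat => j jn.
rewrite add1n subSS.
have uj := uU j jn; have unj : u (n - j)%N \is a GRing.unit by apply: uU; lia.
have [+ _] := lucas_add _ _ _ _ _ hu0 hu1 hu hv0 hv1 hv j (n - j).
rewrite subnKC; last lia.
move=> e; rewrite mulrA e mulrDl invrM // -[v j * _ * _]mulrA mulVKr //.
by rewrite [u j * _]mulrC [_^-1 * _]mulrC -mulrA mulVKr // addrC.
Qed.

Lemma lucas_sum_inv_modulo : (2 : R) \is a GRing.unit -> (0 < n)%N -> u n = 0 ->
  6 * v n * (\sum_(1 <= j < n) (u j * u (n - j)%N)^-1) = (n ^ 2 - 1)%:R * Delta.
Proof.
case: n uU => // m uU' u2 _ um.
(* The ratio has a pole at [0]; the value [0] there keeps [x] odd on the whole group. *)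
pose x (i : 'I_m.+1) : R := if i == 0 then 0 else v i / u i.
have uI (i : 'I_m.+1) : i != 0 -> u i \is a GRing.unit.
  by move=> i0; apply: uU'; rewrite ltn_ord lt0n i0.
have add3 i j k : u i \is a GRing.unit -> u j \is a GRing.unit -> u k \is a GRing.unit ->
    u (i + j + k)%N = 0 ->
    (v i / u i) * (v j / u j) + (v j / u j) * (v k / u k) + (v k / u k) * (v i / u i) = - Delta.
  move=> ui uj uk e; have := lucas_add3 _ _ _ _ _ hu0 hu1 hu hv0 hv1 hv i j k.
  rewrite e mulr0 -/Delta => {}e.
  apply: (mulrI ui); apply: (mulrI uj); apply: (mulrI uk); apply/eqP; rewrite -subr_eq0.
  apply/eqP; rewrite -[LHS]subr0 [X in _ - X]e.
  (* The inverses are named so that [ring] sees the relations a * a^-1 = 1. *)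
  have cU (a : R) : a \is a GRing.unit -> exists2 b, a^-1 = b & a * b = 1.
    by move=> ua; exists a^-1; rewrite ?divrr.
  have [a -> ea] := cU _ ui; have [b -> eb] := cU _ uj; have [c -> ec] := cU _ uk.
  transitivity (v i * v j * u k * ((u i * a) * (u j * b) - 1) +
    v j * v k * u i * ((u k * c) * (u j * b) - 1) + v k * v i * u j * ((u i * a) * (u k * c) - 1)).
    by ring.
  by rewrite ea eb ec; ring.
have add2 i j : u i \is a GRing.unit -> u j \is a GRing.unit -> u (i + j)%N = 0 ->
    v i / u i = - (v j / u j).
  move=> ui uj e; have [+ _] := lucas_add _ _ _ _ _ hu0 hu1 hu hv0 hv1 hv i j.
  rewrite e mulr0 => /esym/eqP; rewrite addrC addr_eq0 => /eqP e'.
  by apply: (mulIr uj); rewrite mulrAC e' !mulNr divrK // mulrAC divrr // mul1r.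
(* Three representatives below [m.+1] with zero sum in the group add up to [m.+1] or to [2 * m.+1],
   so [u] must vanish at both. *)
have u2m : u (m.+1 + m.+1)%N = 0.
  have [+ _] := lucas_add _ _ _ _ _ hu0 hu1 hu hv0 hv1 hv m.+1 m.+1.
  by rewrite um mul0r mulr0 addr0 => e; apply: (mulrI u2); rewrite e mulr0.
have x0 : x 0 = 0 by rewrite /x eqxx.
have xN i : x (- i) = - x i.
  rewrite /x oppr_eq0; have [_|i0] := eqVneq; first by rewrite oppr0.
  apply: add2; rewrite ?uI ?oppr_eq0 //=.
  have i0' : (0 < i)%N by rewrite lt0n.
  by rewrite modn_small ?subnK // ?(ltnW (ltn_ord i)) // ltn_subrL i0'.
have xD i j k : i != 0 -> j != 0 -> k != 0 -> i + j + k = 0 ->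
    x i * x j + x j * x k + x k * x i = - Delta.
  move=> i0 j0 k0 ijk; rewrite /x !ifN //; apply: add3; rewrite ?uI //.
  have dv : (m.+1 %| i + j + k)%N.
    by have /(congr1 val)/= := ijk; rewrite modnDml => /eqP.
  have i0' : (0 < i)%N by rewrite lt0n.
  have := ltn_ord i; have := ltn_ord j; have := ltn_ord k.
  case/dvdnP: dv => q e lk lj li.
  have [q1|q2] : q = 1%N \/ q = 2%N by nia.
    by rewrite e q1 mul1n.
  by rewrite e q2 mul2n -addnn.
have := @sum_sqr_odd_triples _ R x Delta u2 x0 xN xD.
rewrite card_ord /= => sq.
have {sq} sq2 : 3 * \sum_(1 <= j < m.+1) (v j / u j) ^+ 2 = - ((m * m.-1)%:R * Delta).
  rewrite -sq; congr (_ * _); rewrite sum_ord_neq0 [RHS](bigD1 0) //= x0 expr0n add0r.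
  by apply: eq_bigr => i i0; rewrite /x ifN.
have -> : 6 * v m.+1 * (\sum_(1 <= j < m.+1) (u j * u (m.+1 - j)%N)^-1) =
    3 * \sum_(1 <= j < m.+1) (Delta - (v j / u j) ^+ 2).
  rewrite (natrM _ 3 2) -!mulrA; congr (_ * _); rewrite !mulr_sumr.
  apply: eq_big_nat => j jm.
  have uj := uU' j jm; have umj : u (m.+1 - j)%N \is a GRing.unit by apply: uU'; lia.
  have [_] := lucas_add _ _ _ _ _ hu0 hu1 hu hv0 hv1 hv j (m.+1 - j).
  rewrite subnKC -/Delta; last lia.
  rewrite mulrA => ->; rewrite mulrDl.
  rewrite -[Delta * u j * _]mulrA mulrK ?unitrM ?uj //.
  rewrite invrM // addrC; congr (_ + _).
  have e : v j / u j = - (v (m.+1 - j)%N / u (m.+1 - j)%N).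
    by apply: add2; rewrite // subnKC //; lia.
  by rewrite expr2 {2}e; ring.
rewrite sumrB sumr_const_nat subSS subn0 mulrBr sq2.
rewrite opprK -mulr_natl.
(* The case [m = 0] is split off because the predecessor [m.-1] truncates there. *)
case: m {x x0 xN xD uI uU' um u2m sq2} => [|m].
  by rewrite mul0n exp1n subnn mulr0n !mul0r mulr0 addr0.
have -> : (m.+2 ^ 2 - 1 = m.+1 * m.+3)%N by lia.
by rewrite /= !natrM; ring.
Qed.
End LucasModulo.

(** The integer numerator on the right does not depend on [R], so what is proved about the sum in
    ['Z_p] transfers to the rational sum. *)
Lemma lucas_sum_inv_den (R : comUnitRingType) (u : nat -> int) (n : nat) :
  (forall j, (0 < j < n)%N -> (u j)%:~R \is a @GRing.unit R) ->
  ((\prod_(1 <= i < n) u i) ^+ 2)%:~R *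
    (\sum_(1 <= j < n) ((u j)%:~R * (u (n - j)%N)%:~R)^-1 : R) =
  (\sum_(1 <= j < n) (\prod_(1 <= i < n | i != j) u i) *
    (\prod_(1 <= i < n | i != (n - j)%N) u i))%:~R.
Proof.
move=> uU; rewrite mulr_sumr rmorph_sum /=; apply: eq_big_nat => j jn.
have nj : (0 < n - j < n)%N by lia.
rewrite expr2 {1}(bigD1_seq j) ?iota_uniq ?mem_index_iota //=.
rewrite (bigD1_seq (n - j)%N) ?iota_uniq ?mem_index_iota //=.
by rewrite -intrM mulrACA !intrM mulrC mulKr // unitrM !uU.
Qed.

(** * Residue rings and coprimality of primitive divisors *)

Lemma Zp_intr_eq0 (p : nat) (z : int) : (1 < p)%N -> (z%:~R == 0 :> 'Z_p) = (p %| z)%Z.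
Proof.
move=> p1; have nat0 (m : nat) : (m%:R == 0 :> 'Z_p) = (p %| m)%N.
  by rewrite -val_eqE /= val_Zp_nat.
by case: (intP z) => [|m|m]; rewrite ?mulrNz ?oppr_eq0 -?pmulrn ?nat0 // dvdzE ?abszN.
Qed.

Lemma Zp_intr_unit (p : nat) (z : int) :
  (1 < p)%N -> (z%:~R \is a @GRing.unit 'Z_p) = coprimez p z.
Proof.
move=> p1; rewrite coprimezE.
by case: (intP z) => [|m|m]; rewrite ?mulrNz ?unitrN -?pmulrn ?unitZpE ?abszN.
Qed.

(* If 2 or 3 divides neither A nor B, it divides u_3 = A^2 - B or
   u_4 = A (A^2 - 2 B), which is where the bound 5 <= n enters. *)
Lemma lucas_primitive_coprime6 (A B w : int) :
  coprimez w A -> coprimez w B -> coprimez w (A ^+ 2 - B) ->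
  coprimez w (A * (A ^+ 2 - 2 * B)) -> coprimez w 6.
Proof.
move=> wA wB w3 w4; rewrite (_ : 6 = Posz 2 * Posz 3) // coprimezMr.
have H (q : nat) : prime q ->
    (coprimez q A -> coprimez q B -> coprimez q (A ^+ 2 - B) ->
     coprimez q (A * (A ^+ 2 - 2 * B)) -> False) -> coprimez w q.
  move=> q_pr; rewrite !coprimezE /= in wA wB w3 w4 *.
  move=> Hq; rewrite coprime_sym prime_coprime //; apply/negP => qw.
  by apply: Hq; [move: wA | move: wB | move: w3 | move: w4];
     apply: coprime_dvdl.
apply/andP; split; apply: H => //; rewrite -!Zp_intr_unit //.
  (* Only the residues of [A] and [B] matter, so all pairs in ['Z_2], then in ['Z_3], are
     checked. *)
  rewrite rmorphB rmorphXn /=; move: (A%:~R) (B%:~R).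
  by do 2 case=> [[|[|//]] ?].
rewrite rmorphM !rmorphB /= !rmorphXn rmorphM /=; move: (A%:~R) (B%:~R).
by do 2 case=> [[|[|[|//]]] ?].
Qed.

Lemma lucas_primitive_coprime (A B : int) (u v : nat -> int)
    (hu0 : u 0%N = 0) (hu1 : u 1%N = 1)
    (hu : forall n : nat, u n.+2 = A * u n.+1 - B * u n)
    (hv0 : v 0%N = 2) (hv1 : v 1%N = A)
    (hv : forall n : nat, v n.+2 = A * v n.+1 - B * v n) (n : nat) (w : int) :
  (5 <= n)%N -> (w %| u n)%Z -> (forall j, (1 <= j < n)%N -> coprimez w (u j)) ->
  coprimez w 6 /\ coprimez w (v n).
Proof.
move=> n5 /dvdzP[q un] wu.
have u2 : u 2 = A by rewrite hu hu0 hu1; ring.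
have u3 : u 3 = A ^+ 2 - B by rewrite hu u2 hu1; ring.
have u4 : u 4 = A * (A ^+ 2 - 2 * B) by rewrite hu u3 u2; ring.
have wA : coprimez w A by rewrite -u2 wu //; lia.
(* Modulo [w] the recurrence reads [A * u (n-1) = B * u (n-2)], and the left side is invertible. *)
have wB : coprimez w B.
  case: n n5 un wu => [|[|n]] // n5; rewrite hu => un wu.
  have : coprimez w (A * u n.+1) by rewrite coprimezMr wA wu //; lia.
  case/coprimezP => -[s t] /= st; apply/coprimezP; exists (s + t * q, t * u n) => /=.
  rewrite -st; have -> : A * u n.+1 = q * w + B * u n by rewrite -un; ring.
  by ring.
have w6 : coprimez w 6.
  apply: (@lucas_primitive_coprime6 A B) => //.
    by rewrite -u3 wu //; lia.
  by rewrite -u4 wu //; lia.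
split=> //.
have := @lucas_norm _ A B u v hu0 hu1 hu hv0 hv1 hv n isT.
have : coprimez w (4 * B ^+ n).
  rewrite coprimezMr coprimezXr // andbT.
  have : coprimez w ((2%:R : int) * 3%:R) := w6.
  by rewrite (natrM _ 2 2) !coprimezMr => /andP[->].
case/coprimezP => -[s t] /= st e; apply/coprimezP.
(* Substituting the norm identity and [u n = q * w] into the Bezout relation for [4 * B ^+ n] gives
   these coefficients. *)
exists (s - t * (A ^+ 2 - 4 * B) * q ^+ 2 * w, t * v n) => /=.
by rewrite -[RHS]st -e un; ring.
Qed.

Theorem theorem1p1 (A B : int) (u v : nat -> int)
  (hA : A != 0) (hB : B != 0)
  (hu0 : u 0%N = 0) (hu1 : u 1%N = 1)
  (hu : forall n : nat, u n.+2 = A * u n.+1 - B * u n)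
  (hv0 : v 0%N = 2) (hv1 : v 1%N = A)
  (hv : forall n : nat, v n.+2 = A * v n.+1 - B * v n)
  :
  forall (n : nat) (w : int), (5 <= n)%N -> is_wn u n w ->
    rat_congr (w ^+ 2)
      (\sum_(1 <= j < n) ((v j)%:~R / (u j)%:~R : rat))
      (((n ^ 2 - 1)%:R * (A ^+ 2 - 4 * B)%:~R / 6) * ((u n)%:~R / (v n)%:~R)).
Proof.
move=> n [p|p] n5 [w0 wun wu _] //.
(* ['Z_p] is the ring of residues modulo [p] only for [p > 1]; modulo 1 every congruence holds. *)
have [p1|p1] : p = 1%N \/ (1 < p)%N by lia.
  rewrite p1 /rat_congr; set d : rat := _ - _; exists (numq d), (denq d).
  by rewrite expr1n coprimezE coprimen1 dvd1z divq_num_den.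
have [w6 wv] := @lucas_primitive_coprime A B u v hu0 hu1 hu hv0 hv1 hv n p n5 wun wu.
pose D := \prod_(1 <= i < n) u i.
pose N := \sum_(1 <= j < n) (\prod_(1 <= i < n | i != j) u i) *
    (\prod_(1 <= i < n | i != (n - j)%N) u i).
have wD : coprimez p D.
  rewrite /D big_nat; elim/big_ind: _ => //; first by rewrite coprimezE coprimen1.
  by move=> x y wx wy; rewrite coprimezMr wx.
have nz x : coprimez p x -> x != 0.
  by apply: contraTneq => ->; rewrite coprimezE /coprime gcdn0 neq_ltn p1 orbT.
have luc (R : pzRingType) (s : nat -> int) :
    (forall m, s m.+2 = A * s m.+1 - B * s m) ->
    forall m, (s m.+2)%:~R = A%:~R * (s m.+1)%:~R - B%:~R * (s m)%:~R :> R.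
  by move=> hs m; rewrite hs rmorphB !rmorphM.
have uZ j : (0 < j < n)%N -> (u j)%:~R \is a @GRing.unit 'Z_p.
  by move=> jn; rewrite Zp_intr_unit // wu.
have uQ j : (0 < j < n)%N -> (u j)%:~R \is a @GRing.unit rat.
  by move=> jn; rewrite unitfE intr_eq0 nz // wu.
have unit2 : (2 : 'Z_p) \is a GRing.unit.
  have : coprimez p ((2%:R : int) * 3%:R) := w6.
  rewrite coprimezMr => /andP[w2 _].
  by rewrite (_ : 2 = (2 : int)%:~R) // Zp_intr_unit.
have u0R (R : pzRingType) : (u 0%N)%:~R = 0 :> R by rewrite hu0.
have u1R (R : pzRingType) : (u 1%N)%:~R = 1 :> R by rewrite hu1.
have v0R (R : pzRingType) : (v 0%N)%:~R = 2 :> R by rewrite hv0.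
have v1R (R : pzRingType) : (v 1%N)%:~R = A%:~R :> R by rewrite hv1.
have := @lucas_sum_inv_modulo 'Z_p A%:~R B%:~R (fun j => (u j)%:~R) (fun j => (v j)%:~R)
  (u0R _) (u1R _) (luc _ _ hu) (v0R _) (v1R _) (luc _ _ hv) n uZ unit2.
have -> : (u n)%:~R = 0 :> 'Z_p by apply/eqP; rewrite Zp_intr_eq0.
have -> : (0 < n)%N by lia.
move=> /(_ isT erefl) TZ.
have NZ := @lucas_sum_inv_den 'Z_p u n uZ.
have NQ := @lucas_sum_inv_den rat u n uQ.
rewrite -/D -/N in NZ NQ.
rewrite (@lucas_sum_fold rat A%:~R B%:~R (fun j => (u j)%:~R) (fun j => (v j)%:~R)
  (u0R _) (u1R _) (luc _ _ hu) (v0R _) (v1R _) (luc _ _ hv) n uQ) //.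
(* The evaluation in ['Z_p], multiplied by [D ^+ 2] and lifted to integers. *)
have dvd : (p %| 6 * v n * N - D ^+ 2 * ((n ^ 2 - 1)%:R * (A ^+ 2 - 4 * B)))%Z.
  rewrite -Zp_intr_eq0 // rmorphB /= subr_eq0; apply/eqP.
  have -> : (6 * v n * N)%:~R = (6 * (v n)%:~R) * N%:~R :> 'Z_p.
    by rewrite !rmorphM rmorph_nat.
  have -> : (D ^+ 2 * ((n ^ 2 - 1)%:R * (A ^+ 2 - 4 * B)))%:~R =
      (D ^+ 2)%:~R * ((n ^ 2 - 1)%:R * (A%:~R ^+ 2 - 4 * B%:~R)) :> 'Z_p.
    rewrite intrM; congr (_ * _).
    by rewrite rmorphM rmorph_nat rmorphB rmorphXn rmorphM.
  by rewrite -TZ -NZ mulrCA.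
(* The difference of the two sides over the common denominator [6 * v n * D ^+ 2]; [p] divides both
   factors of this numerator. *)
exists (u n * (6 * v n * N - D ^+ 2 * ((n ^ 2 - 1)%:R * (A ^+ 2 - 4 * B)))).
exists (6 * v n * D ^+ 2); split.
  apply: (@coprimezXr 2 _ p).
  by rewrite coprimez_sym !coprimezMr w6 wv wD.
split; first by rewrite expr2 dvdz_mul.
have vn0 : (v n)%:~R != 0 :> rat by rewrite intr_eq0 nz.
have D0 : D%:~R != 0 :> rat by rewrite intr_eq0 nz.
rewrite (_ : \sum_(1 <= j < n) _ = N%:~R / (D%:~R ^+ 2)); last first.
  by rewrite -NQ rmorphXn mulrAC divff ?mul1r // expf_neq0.
rewrite !(rmorphM, rmorphB, rmorphXn, rmorph_nat) /=.
by field; rewrite vn0 D0.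
Qed.
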